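(* Every circulant graph of odd prime order is stable. That is, for every odd prime $p$ and every nonempty inverse-closed subset $S$ of $\mathbb{Z}_p\setminus\{0\}$, the Cayley graph $\mathrm{Cay}(\mathbb{Z}_p,S)$ is stable.
   Context: All graphs are finite, simple and undirected. For a group $G$ and a nonempty inverse-closed subset $S$ of $G\setminus\{1\}$, the Cayley graph $\mathrm{Cay}(G,S)$ has vertex set $G$, with $x,y$ adjacent if and only if $yx^{-1}\in S$. A circulant graph (circulant) is a Cayley graph of a cyclic group. The canonical double cover $\mathrm{D}(\Gamma)$ of a graph $\Gamma$ is the graph with vertex set $V(\Gamma)\times\mathbb{Z}_2$ in which $(u,x)$ and $(v,y)$ are adjacent if and only if $u$ and $v$ are adjacent in $\Gamma$ and $x\neq y$. One always has that $\mathrm{Aut}(\Gamma)\times\mathbb{Z}_2$ is isomorphic to a subgroup of $\mathrm{Aut}(\mathrm{D}(\Gamma))$. The graph $\Gamma$ is called stable if $\mathrm{Aut}(\mathrm{D}(\Gamma))\cong\mathrm{Aut}(\Gamma)\times\mathbb{Z}_2$, and unstable otherwise. *)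

(* Defs.v *)
From mathcomp Require Import all_boot all_order all_fingroup all_algebra.

Set Implicit Arguments.
Unset Strict Implicit.
Unset Printing Implicit Defensive.

Import GRing.Theory.

(* A finite simple graph is given by its adjacency relation e : rel V. *)

Section GraphAutomorphisms.

Variables (V : finType) (e : rel V).

Definition graph_aut : {set {perm V}} :=
  [set s : {perm V} | [forall x, forall y, e (s x) (s y) == e x y]].

Lemma graph_autP (s : {perm V}) :
  reflect (forall x y, e (s x) (s y) = e x y) (s \in graph_aut).
Proof.
rewrite inE; apply: (iffP forallP) => [h x y | h x].
  by apply/eqP; move/forallP: (h x).
by apply/forallP => y; rewrite h.
Qed.

Lemma graph_aut_group_set : group_set graph_aut.
Proof.
apply/group_setP; split=> [|s t /graph_autP hs /graph_autP ht].
  by apply/graph_autP => x y; rewrite !perm1.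
by apply/graph_autP => x y; rewrite !permM ht hs.
Qed.

Canonical graph_aut_group := Group graph_aut_group_set.

End GraphAutomorphisms.

Definition double_cover (V : finType) (e : rel V) : rel (V * 'Z_2) :=
  [rel u v | e u.1 v.1 && (u.2 != v.2)].

(* The finGroupType structure of 'Z_2 is the additive one, and setX is the
   external direct product of groups. *)
Definition stable (V : finType) (e : rel V) : bool :=
  (graph_aut (double_cover e) \isog setX (graph_aut e) [set: 'Z_2])%g.

Definition cayley (gT : finGroupType) (S : {set gT}) : rel gT :=
  [rel x y | (y * x^-1)%g \in S].

Section SimpleGraphs.

Variables (V : finType) (e : rel V).

Lemma double_cover_sym : symmetric e -> symmetric (double_cover e).
Proof. by move=> es u v; rewrite /double_cover /= es eq_sym. Qed.

Lemma double_cover_irr : irreflexive (double_cover e).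
Proof. by move=> u; rewrite /double_cover /= eqxx andbF. Qed.

End SimpleGraphs.

Section CayleyGraphs.

Variables (gT : finGroupType) (S : {set gT}).

Lemma cayley_sym :
  (forall x, x \in S -> x^-1%g \in S) -> symmetric (cayley S).
Proof.
move=> hS x y; by apply/idP/idP => /= /hS; rewrite /cayley /= invMg invgK.
Qed.

Lemma cayley_irr : 1%g \notin S -> irreflexive (cayley S).
Proof. by move=> /negPf h x; rewrite /cayley /= mulgV. Qed.

End CayleyGraphs.

(* The finGroupType structure of 'Z_p is the additive one. *)
Lemma cayleyZpE (p : nat) (S : {set 'Z_p}) (x y : 'Z_p) :
  cayley S x y = ((y - x)%R \in S).
Proof. by []. Qed.

(* Main.v *)
Require Import Defs.
From mathcomp Require Import all_boot all_order all_fingroup all_algebra.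

Set Implicit Arguments.
Unset Strict Implicit.
Unset Printing Implicit Defensive.

Import GRing.Theory.
Local Open Scope ring_scope.

(** The proof counts walks of length [p] modulo [p].  The adjacency matrix of
    a circulant graph on Z_p is A = \sum_(s in S) X^s, where X is the matrix of
    the translation x |-> x + 1.  Over F_p the Frobenius map gives
      A^p = \sum_(s in S) X^(p s) = |S| I,
    and |S| is invertible modulo p because S is nonempty and misses 0.  So the
    number of walks of length p from x to y is nonzero modulo p exactly when
    x = y ([walks_cayley_prime]).

    Since p is odd, a walk of length p in the double cover changes the
    Z_2-coordinate, so (x, a + 1) is the only vertex for which the number of
    walks of length p from (x, a) is nonzero modulo p ([walks_double_cover]).
    Automorphisms preserve numbers of walks, hence every automorphism of the double cover commutes
    with the swap (x, a) |-> (x, a + 1), and therefore has the form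
    (x, a) |-> (g x, a + c x).  Comparing adjacent vertices shows that c takes
    equal values at adjacent x and y; as the graph is connected, c is
    constant, and then g is an automorphism of the graph
    ([double_cover_aut_product]).  So the automorphisms of the double cover are
    exactly the pairs (g, c), which is stability ([stable_of_odd_walks]). *)

(** * Numbers of walks *)

Fixpoint walks (V : finType) (e : rel V) (n : nat) (x y : V) : nat :=
  if n is n'.+1 then \sum_z e x z * walks e n' z y else x == y.

Lemma walks_aut (V : finType) (e : rel V) (s : {perm V}) n x y :
  s \in graph_aut e -> walks e n (s x) (s y) = walks e n x y.
Proof.
move=> /graph_autP es; elim: n x => [|n IH] x /=.
  by rewrite (inj_eq perm_inj).
rewrite (reindex_inj (@perm_inj _ s)) /=.
by apply: eq_bigr => z _; rewrite es IH.
Qed.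

Lemma adjacency_mx_walks (R : pzSemiRingType) m (e : rel 'I_m.+1) n x y :
  ((\matrix_(i, j) (e i j)%:R : 'M[R]_m.+1) ^+ n) x y = (walks e n x y)%:R.
Proof.
elim: n x => [|n IH] x; first by rewrite expr0 mxE.
rewrite exprS mxE natr_sum; apply: eq_bigr => z _.
by rewrite mxE IH natrM.
Qed.

Lemma Z2_neq (a b : 'Z_2) : (a != b) = (b == a + 1).
Proof. by case: a b => [[|[|?]] ?] // [[|[|?]] ?]. Qed.

(** Every edge of the double cover flips the Z_2-coordinate, so a walk is
    determined by its projection and its starting point. *)
Lemma walks_double_cover (V : finType) (e : rel V) n (u v : V * 'Z_2) :
  walks (double_cover e) n u v
  = ((v.2 == (u.2 + n%:R)%R) * walks e n u.1 v.1)%N.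
Proof.
case: v => y b; elim: n u => [|n IH] [x a] /=.
  by rewrite addr0 -pair_eqE /= mulnb andbC [b == a]eq_sym.
transitivity (\sum_(w : V * 'Z_2) (e x w.1 * (w.2 == (a + 1)%R)
    * ((b == (w.2 + n%:R)%R) * walks e n w.1 y)))%N.
  by apply: eq_bigr => w _; rewrite IH /double_cover /= Z2_neq mulnb.
rewrite -(pair_bigA _ (fun z c => e x z * (c == (a + 1)%R)
    * ((b == (c + n%:R)%R) * walks e n z y)))%N /= big_distrr.
apply: eq_bigr => z _; rewrite (bigD1 (a + 1)) //= big1 => [|c /negPf->].
  by rewrite eqxx muln1 addn0 mulnCA -addrA -mulrS.
by rewrite muln0.
Qed.

(** * A stability criterion *)

Section Criterion.

Variables (V : finType) (e : rel V).

Definition product_fun (u : {perm V} * 'Z_2) (v : V * 'Z_2) : V * 'Z_2 :=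
  (u.1 v.1, v.2 + u.2).

Lemma product_fun_inj u : injective (product_fun u).
Proof.
move=> [x a] [y b] /eqP; rewrite xpair_eqE (inj_eq perm_inj) (inj_eq (addIr _)).
by rewrite -xpair_eqE => /eqP.
Qed.

Definition product_perm u := perm (@product_fun_inj u).

Lemma product_permM : {morph product_perm : u v / (u * v)%g}.
Proof.
move=> u v; apply/permP => w.
by rewrite permM !permE /product_fun /= permM addrA.
Qed.

(** The point [x0] is needed: over an empty vertex set both elements of Z_2 act
    trivially. *)
Lemma product_perm_inj (x0 : V) : injective product_perm.
Proof.
move=> [s a] [t b] /permP E; congr pair.
  by apply/permP => x; have := E (x, 0); rewrite !permE => -[].
have /(congr1 snd) := E (x0, 0).
by rewrite !permE /product_fun /= !add0r.
Qed.

Lemma product_perm_aut s a :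
  (product_perm (s, a) \in graph_aut (double_cover e)) = (s \in graph_aut e).
Proof.
apply/graph_autP/graph_autP => es.
  move=> x y; have := es (x, 0) (y, 1).
  by rewrite !permE /double_cover /product_fun /= (inj_eq (addIr _)) !andbT.
move=> [x b] [y c].
by rewrite !permE /double_cover /product_fun /= es (inj_eq (addIr _)).
Qed.

(** If walk counts of some odd length [n], taken modulo [d], recognise equality
    of vertices, then in the double cover they recognise the pairs
    (x, a), (x, a + 1).  So an automorphism permutes these pairs, and
    connectedness excludes that it shifts the Z_2-coordinate by different
    amounts over different vertices. *)
Lemma double_cover_aut_product n d (t : {perm V * 'Z_2}) (x0 : V) :
    odd n -> (forall x y, (d %| walks e n x y)%N = (x != y)) ->
    (forall x, connect e x0 x) -> t \in graph_aut (double_cover e) ->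
  exists u, t = product_perm u.
Proof.
move=> n_odd de conn tD.
have n1 : n%:R = 1 :> 'Z_2.
  by rewrite -(Zp_nat_mod (isT : 1 < 2)%N) modn2 n_odd.
have t_swap x a : t (x, a + 1) = ((t (x, a)).1, (t (x, a)).2 + 1).
  have := walks_aut n (x, a) (x, a + 1) tD.
  rewrite !walks_double_cover /= n1 eqxx mul1n => /(congr1 (dvdn d)).
  rewrite de eqxx; case: eqP => [E2|_]; last by rewrite dvdn0.
  rewrite mul1n de => /negbFE/eqP E1.
  by rewrite [LHS]surjective_pairing -E1 E2.
have tE x a : t (x, a) = ((t (x, 0)).1, (t (x, 0)).2 + a).
  have: (a == 0) || (a == 0 + 1) by case: a => [[|[|?]] ?].
  case/orP=> /eqP->; last by rewrite t_swap add0r.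
  by rewrite addr0 -surjective_pairing.
have adj x y a b : e x y ->
    double_cover e (t (x, a)) (t (y, b)) = (a != b).
  by move/graph_autP: tD => ->; rewrite /double_cover /= => ->.
have c_const x : (t (x, 0)).2 = (t (x0, 0)).2.
  have /connectP[q + ->] := conn x.
  elim: q x0 {conn x} => //= y q IH z /andP[ezy yq].
  rewrite IH //; have := adj _ _ 0 1 ezy; rewrite (tE y 1) /= => /andP[_].
  by rewrite Z2_neq => /eqP/addIr.
have g_inj : injective (fun x => (t (x, 0)).1).
  move=> x y /= E; have: t (x, 0) = t (y, 0); last by move/perm_inj=> [].
  by rewrite [LHS]surjective_pairing [RHS]surjective_pairing E !c_const.
exists (perm g_inj, (t (x0, 0)).2); apply/permP => -[x a].
by rewrite tE !permE /product_fun /= permE c_const addrC.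
Qed.

Theorem stable_of_odd_walks n d (x0 : V) :
    odd n -> (forall x y, (d %| walks e n x y)%N = (x != y)) ->
    (forall x, connect e x0 x) ->
  stable e.
Proof.
move=> n_odd de conn; rewrite /stable; apply: isog_symr.
pose f :=
  Morphism (in2W product_permM : {in setX (graph_aut e) [set: 'Z_2] &, _}).
apply/isogP; exists f.
  by apply/injmP; apply: in2W; exact: product_perm_inj.
rewrite morphimEdom; apply/setP => t; apply/imsetP/idP => [[[s a] + ->]|tD].
  by rewrite in_setX in_setT andbT /= product_perm_aut.
have [[s a] ts] := double_cover_aut_product n_odd de conn tD.
exists (s, a) => //.
by rewrite in_setX in_setT andbT -(product_perm_aut s a) -ts.
Qed.

End Criterion.

(** * Walks of prime length in circulant graphs *)

Lemma sum_bool_card (T : finType) (A : {set T}) (P : pred T) :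
  (\sum_(s in A) P s)%N = #|[set s in A | P s]|.
Proof.
rewrite -sum1dep_card big_mkcondr; apply: eq_bigr => s _.
by case: (P s).
Qed.

(** The adjacency matrix is q(X), with X the matrix of x |-> x + 1 and q the sum
    of the monomials with exponents in S.  Writing it as a polynomial in one
    matrix allows the Frobenius map to be applied in the commutative ring
    F_p[X], where q ^+ p is the sum of the p-th powers of these monomials. *)
Lemma walks_cayley_prime m p (S : {set 'Z_m}) x y :
  prime p ->
  walks (cayley S) p x y = #|[set s in S | y == x + s *+ p]| %[mod p].
Proof.
move=> p_pr; have pFp := pchar_Fp p_pr.
pose X : 'M['F_p]_((Zp_trunc m).+2) := \matrix_(i, j) (j == i + 1)%:R.
have XnE k i j : (X ^+ k) i j = (j == i + k%:R)%:R.
  elim: k i => [|k IH] i; first by rewrite expr0 mxE addr0 eq_sym.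
  rewrite exprS mxE (bigD1 (i + 1)) //= mxE eqxx mul1r IH big1.
    by rewrite addr0 -addrA mulrS.
  by move=> l /negPf li; rewrite mxE li mul0r.
pose q : {poly 'F_p} := \sum_(s in S) 'X^s.
have AE : \matrix_(i, j) (cayley S i j)%:R = horner_mx X q.
  rewrite rmorph_sum; apply/matrixP => i j; rewrite mxE summxE.
  under eq_bigr do rewrite rmorphXn /= horner_mx_X XnE natr_Zp addrC -subr_eq.
  rewrite -natr_sum sum_bool_card cayleyZpE; congr _%:R.
  have [jS|jS] := boolP (j - i \in S).
    rewrite (_ : finset _ = [set j - i]) ?cards1 //.
    apply/setP=> s; rewrite !inE eq_sym.
    by case: eqP => [->|]; rewrite ?jS ?andbF.
  rewrite (_ : finset _ = set0) ?cards0 //; apply/setP=> s; rewrite !inE eq_sym.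
  by case: eqP => [->|]; rewrite ?(negPf jS) ?andbF.
have qp : q ^+ p = \sum_(s in S) 'X^(s * p).
  have pP : p \in [pchar {poly 'F_p}] by rewrite pchar_poly.
  rewrite -(pFrobenius_autE pP) rmorph_sum.
  by apply: eq_bigr => s _; rewrite /= pFrobenius_autE -exprM.
have : (walks (cayley S) p x y)%:R
     = #|[set s in S | y == x + s *+ p]|%:R :> 'F_p.
  rewrite -adjacency_mx_walks AE -rmorphXn qp rmorph_sum summxE -sum_bool_card.
  rewrite natr_sum; apply: eq_bigr => s _.
  by rewrite rmorphXn /= horner_mx_X XnE natrM natr_Zp mulr_natr.
by move/(congr1 val); rewrite /= !val_Fp_nat.
Qed.

(** The criterion applies with walks of length p counted modulo p.  As
    s *+ p = 0 in Z_p, the count from x to y is |S| if x = y and 0 otherwise,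
    with 0 < |S| < p; and the graph is connected because every nonzero s in S
    generates Z_p. *)
Theorem theorem1p4 (p : nat) (S : {set 'Z_p}) :
  prime p -> odd p ->
  S != set0 -> 0 \notin S -> (forall x : 'Z_p, x \in S -> - x \in S) ->
  stable (cayley S).
Proof.
move=> p_pr p_odd /set0Pn[s sS] S0 _; have p_gt1 := prime_gt1 p_pr.
apply: (@stable_of_odd_walks _ _ p p 0) => // [x y|x].
  rewrite /dvdn walks_cayley_prime // -/(dvdn _ _).
  under eq_finset do rewrite -mulr_natr pchar_Zp // mulr0 addr0.
  have [_|_] := eqVneq x y; last first.
    rewrite (_ : finset _ = set0) ?cards0 ?dvdn0 //.
    by apply/setP=> z; rewrite !inE andbF.
  rewrite (_ : finset _ = S); last by apply/setP=> z; rewrite !inE andbT.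
  rewrite gtnNdvd //; first by apply/card_gt0P; exists s.
  have : S \proper setT by apply/properP; split; [exact: subsetT | exists 0].
  by move/proper_card/leq_trans; apply; rewrite cardsT card_ord Zp_cast.
have su : s \is a GRing.unit.
  rewrite -[s]natr_Zp unitZpE // prime_coprime // gtnNdvd //.
    rewrite lt0n; apply: contraNneq S0 => s0.
    by rewrite -[0](_ : s = _) //; apply/val_inj.
  by rewrite -[X in (_ < X)%N](Zp_cast p_gt1).
(* x is reached from 0 by x / s steps, each adding s *)
rewrite -[x](divrK su) -[x / s]natr_Zp mulr_natl.
elim: (nat_of_ord _) => [|k IH]; first exact: connect0.
apply: connect_trans IH (connect1 _).
by rewrite cayleyZpE mulrS addrK.
Qed.
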